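(* Assume that the spectrum of $A\in\mathbb R^{d,d}$ consists of one eigenvalue $\lambda\in\mathbb R$, $\lambda\ne0$. Then all eight first angular values of $A$ vanish, i.e. $$\check\theta_{[1]}(A)=\check\theta_1(A)=\hat\theta_1(A)=\hat\theta_{[1]}(A)=\underline\theta_{[1]}(A)=\underline\theta_1(A)=\bar\theta_1(A)=\bar\theta_{[1]}(A)=0.$$
   Context: $\mathcal G(1,d)$ is the set of one-dimensional subspaces of $\mathbb R^d$, and for $V=\mathrm{span}(v)$, $W=\mathrm{span}(w)$, $\measuredangle(V,W)=\arccos\frac{|v^\top w|}{\|v\|\|w\|}\in[0,\frac\pi2]$. For an invertible $A\in\mathbb R^{d,d}$, $V\in\mathcal G(1,d)$, $n\in\mathbb N$, $k\in\mathbb N_0$ let $a_{k+1,k+n}(V)=\sum_{j=k+1}^{k+n}\measuredangle(A^{j-1}V,A^jV)$. With suprema over $V\in\mathcal G(1,d)$, the first angular values of $A$ are: inner: $\bar\theta_1=\limsup_{n\to\infty}\frac1n\sup_Va_{1,n}(V)$, $\underline\theta_1=\liminf_{n\to\infty}\frac1n\sup_Va_{1,n}(V)$; outer: $\hat\theta_1=\sup_V\limsup_{n\to\infty}\frac1na_{1,n}(V)$, $\check\theta_1=\sup_V\liminf_{n\to\infty}\frac1na_{1,n}(V)$; uniform inner: $\bar\theta_{[1]}=\limsup_{n\to\infty}\frac1n\sup_V\sup_{k\in\mathbb N_0}a_{k+1,k+n}(V)$, $\underline\theta_{[1]}=\liminf_{n\to\infty}\frac1n\sup_V\inf_{k\in\mathbb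 N_0}a_{k+1,k+n}(V)$; uniform outer: $\hat\theta_{[1]}=\sup_V\lim_{n\to\infty}\frac1n\sup_{k\in\mathbb N_0}a_{k+1,k+n}(V)$, $\check\theta_{[1]}=\sup_V\lim_{n\to\infty}\frac1n\inf_{k\in\mathbb N_0}a_{k+1,k+n}(V)$ (the limits exist by Fekete's lemma). *)

(* Defs.v *)
From HB Require Import structures.
From mathcomp Require Import all_boot all_order all_algebra.
From mathcomp Require Import all_classical all_reals all_analysis.
From mathcomp Require Import complex.
From mathcomp Require Import zify ring lra.

Set Implicit Arguments.
Unset Strict Implicit.
Unset Printing Implicit Defensive.

Import Order.TTheory GRing.Theory Num.Theory.
Import numFieldNormedType.Exports.

Local Open Scope classical_set_scope.
Local Open Scope ring_scope.

(* The complex spectrum of a real matrix.  [eigenvalue] speaks of row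
   eigenvectors, which gives the same set of eigenvalues. *)
Definition spectrum (R : realType) (d : nat) (A : 'M[R]_d) : set (complex R) :=
  [set z | eigenvalue (map_mx (real_complex R) A) z].

Section Angle.
Variables (R : realType) (d : nat).
Implicit Types (u v w : 'cV[R]_d) (U V W : {vspace 'cV[R]_d}).

Definition dot v w : R := (v^T *m w) 0 0.

(* The norm `|v| of the library on matrices is the max norm. *)
Definition enorm v : R := Num.sqrt (dot v v).

Definition vangle v w : R := acos (`|dot v w| / (enorm v * enorm w)).

Definition grassmannian (k : nat) : set {vspace 'cV[R]_d} :=
  [set V | \dim V = k].

(* [vpick V] spans V when V is a line; [angle_line] below shows that any other
   spanning vectors give the same value. *)
Definition angle V W : R := vangle (vpick V) (vpick W).

Lemma dotE v w : dot v w = \sum_i v i 0 * w i 0.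
Proof. by rewrite /dot mxE; apply: eq_bigr => i _; rewrite mxE. Qed.

Lemma dotC v w : dot v w = dot w v.
Proof. by rewrite !dotE; apply: eq_bigr => i _; rewrite mulrC. Qed.

Lemma dotZl (a : R) v w : dot (a *: v) w = a * dot v w.
Proof.
by rewrite !dotE mulr_sumr; apply: eq_bigr => i _; rewrite mxE mulrA.
Qed.

Lemma dotZr (a : R) v w : dot v (a *: w) = a * dot v w.
Proof. by rewrite dotC dotZl dotC. Qed.

Lemma dotBl u v w : dot (u - v) w = dot u w - dot v w.
Proof.
rewrite !dotE -sumrB; apply: eq_bigr => i _.
by rewrite !mxE mulrBl.
Qed.

Lemma dotBr u v w : dot u (v - w) = dot u v - dot u w.
Proof. by rewrite dotC dotBl !(dotC u). Qed.

Lemma dot_ge0 v : 0 <= dot v v.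
Proof. by rewrite dotE; apply: sumr_ge0 => i _; rewrite -expr2 sqr_ge0. Qed.

Lemma cauchy_schwarz v w : dot v w ^+ 2 <= dot v v * dot w w.
Proof.
have [w0|w0] := eqVneq (dot w w) 0.
  suff -> : dot v w = 0 by rewrite expr0n /= w0 mulr0.
  move/eqP: w0; rewrite !dotE psumr_eq0; last by move=> i _; exact: sqr_ge0.
  move=> /allP w0; apply: big1 => i _.
  have /= := w0 i (mem_index_enum i).
  by rewrite mulf_eq0 orbb => /eqP ->; rewrite mulr0.
have wgt0 : 0 < dot w w by rewrite lt_neqAle eq_sym w0 dot_ge0.
have := dot_ge0 (dot w w *: v - dot v w *: w).
rewrite dotBl !dotBr !dotZl !dotZr (dotC w v) => h.
rewrite -subr_ge0 -(pmulr_rge0 _ wgt0).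
by apply: le_trans h _; rewrite le_eqVlt; apply/orP; left; apply/eqP; ring.
Qed.

Lemma enormM v w : enorm v * enorm w = Num.sqrt (dot v v * dot w w).
Proof. by rewrite /enorm sqrtrM // dot_ge0. Qed.

Lemma cosine_bounds v w : 0 <= `|dot v w| / (enorm v * enorm w) <= 1.
Proof.
have n0 : 0 <= enorm v * enorm w by rewrite mulr_ge0 // sqrtr_ge0.
rewrite divr_ge0 //=.
have [->|nn0] := eqVneq (enorm v * enorm w) 0; first by rewrite invr0 mulr0.
rewrite ler_pdivrMr ?mul1r; last by rewrite lt_neqAle eq_sym nn0.
by rewrite enormM -sqrtr_sqr ler_wsqrtr // cauchy_schwarz.
Qed.

Lemma vangle_bounds v w : 0 <= vangle v w <= pi.
Proof.
have /andP[h0 h1] := cosine_bounds v w.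
have h : -1 <= `|dot v w| / (enorm v * enorm w) <= 1.
  by rewrite h1 (le_trans _ h0) // oppr_le0.
by rewrite /vangle acos_ge0 ?acos_lepi.
Qed.

Lemma vangleZ (a b : R) v w : a != 0 -> b != 0 ->
  vangle (a *: v) (b *: w) = vangle v w.
Proof.
move=> a0 b0; rewrite /vangle !enormM !dotZl !dotZr; congr (acos _).
have -> : a * (a * dot v v) * (b * (b * dot w w))
  = (a * b) ^+ 2 * (dot v v * dot w w) by ring.
rewrite sqrtrM ?sqr_ge0 // sqrtr_sqr !mulrA -(mulrC b) normrM.
rewrite (mulrC b) -mulf_div divff ?mul1r // normr_eq0 mulf_neq0 //.
Qed.

Lemma vpick_line v : v != 0 -> exists2 a : R, a != 0 & vpick <[v]>%VS = a *: v.
Proof.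
move=> v0; have /vlineP[a pa] := memv_pick <[v]>%VS.
exists a => //; apply: contraNneq v0 => a0.
by rewrite -memv0 -(_ : <[v]> = 0)%VS ?memv_line //; apply/eqP;
   rewrite -vpick0 pa a0 scale0r.
Qed.

Lemma angle_line v w : v != 0 -> w != 0 -> angle <[v]>%VS <[w]>%VS = vangle v w.
Proof.
move=> /vpick_line[a a0 ea] /vpick_line[b b0 eb].
by rewrite /angle ea eb vangleZ.
Qed.

End Angle.

Section AngularValues.
Variables (R : realType) (d : nat) (A : 'M[R]_d).
Implicit Types V : {vspace 'cV[R]_d}.

Definition pow_image (j : nat) V : {vspace 'cV[R]_d} :=
  iter j (fun U => linfun (mulmx A : 'cV[R]_d -> 'cV[R]_d) @: U)%VS V.

(* [angle_sum k n V] is the sum a_{k+1,k+n}(V). *)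
Definition angle_sum (k n : nat) V : R :=
  \sum_(k.+1 <= j < (k + n).+1) angle (pow_image j.-1 V) (pow_image j V).

(* The sums are bounded, so the suprema are finite; they are taken in \bar R,
   where they are total. *)
Local Notation sup_lines F :=
  (ereal_sup [set F V | V in @grassmannian R d 1]).
Local Notation sup_shifts V n :=
  (ereal_sup [set (angle_sum k n V)%:E | k in [set: nat]]).
Local Notation inf_shifts V n :=
  (ereal_inf [set (angle_sum k n V)%:E | k in [set: nat]]).

Local Open Scope ereal_scope.

Definition inner_upper : \bar R :=
  limn_esup (fun n => (n%:R^-1)%:E * sup_lines (fun V => (angle_sum 0 n V)%:E)).

Definition inner_lower : \bar R :=
  limn_einf (fun n => (n%:R^-1)%:E * sup_lines (fun V => (angle_sum 0 n V)%:E)).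

Definition outer_upper : \bar R :=
  sup_lines (fun V => limn_esup (fun n => (n%:R^-1)%:E * (angle_sum 0 n V)%:E)).

Definition outer_lower : \bar R :=
  sup_lines (fun V => limn_einf (fun n => (n%:R^-1)%:E * (angle_sum 0 n V)%:E)).

Definition uniform_inner_upper : \bar R :=
  limn_esup (fun n => (n%:R^-1)%:E * sup_lines (fun V => sup_shifts V n)).

Definition uniform_inner_lower : \bar R :=
  limn_einf (fun n => (n%:R^-1)%:E * sup_lines (fun V => inf_shifts V n)).

(* The two limits below exist: see [cvg_sup_shifts] and [cvg_inf_shifts]. *)
Definition uniform_outer_upper : \bar R :=
  sup_lines (fun V => limn (fun n => (n%:R^-1)%:E * sup_shifts V n)).

Definition uniform_outer_lower : \bar R :=
  sup_lines (fun V => limn (fun n => (n%:R^-1)%:E * inf_shifts V n)).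

End AngularValues.

Section Fekete.
Variable R : realType.

Lemma fekete (b : nat -> R) (C : R) :
  (forall m n, b (m + n)%N <= b m + b n) ->
  (forall n, 0 <= b n <= C * n%:R) ->
  cvgn (fun n => n%:R^-1 * b n).
Proof.
move=> sub bd.
have C0 : 0 <= C by have /andP[h /(le_trans h)] := bd 1%N; rewrite mulr1.
pose S : set R := [set (m.+1%:R^-1 * b m.+1) | m in [set: nat]].
have Slb : has_lbound S.
  exists 0 => _ [m _ <-]; rewrite mulr_ge0 ?invr_ge0 //.
  by have /andP[] := bd m.+1.
have Sinf : has_inf S by split=> //; exists (1%:R^-1 * b 1%N); exists 0%N.
have bq m q r : b (q * m + r)%N <= q%:R * b m + b r.
  elim: q => [|q IH]; first by rewrite mul0n mul0r add0r.
  rewrite mulSn -addnA (le_trans (sub _ _)) // -natr1 mulrDl mul1r.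
  by rewrite (addrC (_ * _)) -addrA lerD2l.
apply/cvg_ex; exists (inf S); apply/cvgrPdist_le => e e0.
have e20 : 0 < e / 2 by rewrite divr_gt0.
have [_ [m _ <-] hm] := @inf_adherent _ S _ e20 Sinf.
near=> n.
have n0 : (0 < n)%N by near: n; exact: nbhs_infty_gt.
have nR : 0 < n%:R :> R by rewrite ltr0n.
have lb : inf S <= n%:R^-1 * b n.
  by apply: ge_inf => //; exists n.-1 => //; rewrite prednK.
rewrite distrC ger0_norm ?subr_ge0 // lerBlDl.
have big : C * m.+1%:R <= e / 2 * n%:R.
  rewrite mulrC -ler_pdivrMl // invfM invrK mulrC -mulrA.
  by near: n; exact: nbhs_infty_ger.
rewrite mulrC ler_pdivrMr // {1}(divn_eq n m.+1).
apply: le_trans (bq _ _ _) _.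
have hr : b (n %% m.+1)%N <= C * m.+1%:R.
  have /andP[_ h] := bd (n %% m.+1)%N; apply: le_trans h _.
  by rewrite ler_wpM2l // ler_nat ltnW // ltn_pmod.
have hq : (n %/ m.+1)%:R * b m.+1 <= n%:R * (m.+1%:R^-1 * b m.+1).
  rewrite mulrA ler_wpM2r //; first by have /andP[] := bd m.+1.
  by rewrite ler_pdivlMr ?ltr0n // -natrM ler_nat leq_divM.
have hL : n%:R * (m.+1%:R^-1 * b m.+1) <= n%:R * (inf S + e / 2).
  by rewrite ler_wpM2l // ltW.
apply: le_trans (lerD (le_trans hq hL) (le_trans hr big)) _.
by rewrite le_eqVlt; apply/orP; left; apply/eqP; field.
Unshelve. all: by end_near. Qed.

End Fekete.

Section LimitsExist.
Variables (R : realType) (d : nat) (A : 'M[R]_d) (V : {vspace 'cV[R]_d}).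
Local Notation a k n := (angle_sum A k n V).

Lemma angle_sumD k m n : a k (m + n) = a k m + a (k + m) n.
Proof. by rewrite /angle_sum (big_cat_nat (n := (k + m).+1)) /= ?addnA //; lia. Qed.

Lemma angle_sum_bounds k n : 0 <= a k n <= pi * n%:R.
Proof.
apply/andP; split.
  by apply: sumr_ge0 => j _; have /andP[] := vangle_bounds
       (vpick (pow_image A j.-1 V)) (vpick (pow_image A j V)).
have -> : pi * n%:R = \sum_(k.+1 <= j < (k + n).+1) pi :> R.
  by rewrite sumr_const_nat subSS addKn mulr_natr.
apply: ler_sum => j _; by have /andP[] := vangle_bounds
       (vpick (pow_image A j.-1 V)) (vpick (pow_image A j V)).
Qed.

Let s n : R := sup [set a k n | k in [set: nat]].
Let i n : R := inf [set a k n | k in [set: nat]].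

Let ub n : has_ubound [set a k n | k in [set: nat]].
Proof.
by exists (pi * n%:R) => _ [k _ <-]; have /andP[] := angle_sum_bounds k n.
Qed.

Let lb n : has_lbound [set a k n | k in [set: nat]].
Proof. by exists 0 => _ [k _ <-]; have /andP[] := angle_sum_bounds k n. Qed.

Let ne n : [set a k n | k in [set: nat]] !=set0.
Proof. by exists (a 0 n); exists 0%N. Qed.

Let les k n : a k n <= s n.
Proof. by apply: ub_le_sup => //; exists k. Qed.

Let gei k n : i n <= a k n.
Proof. by apply: ge_inf => //; exists k. Qed.

Let sE n : ereal_sup [set (a k n)%:E | k in [set: nat]] = (s n)%:E.
Proof. by rewrite -ereal_sup_EFin // image_comp. Qed.

Let iE n : ereal_inf [set (a k n)%:E | k in [set: nat]] = (i n)%:E.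
Proof. by rewrite -ereal_inf_EFin // image_comp. Qed.

Lemma cvg_sup_shifts : cvgn (fun n =>
  (n%:R^-1)%:E * ereal_sup [set (a k n)%:E | k in [set: nat]])%E.
Proof.
have /cvg_ex[l hl] : cvgn (fun n => n%:R^-1 * s n).
  apply: (@fekete _ _ pi) => [m n|n].
    apply: ge_sup => // _ [k _ <-].
    by rewrite angle_sumD lerD.
  apply/andP; split.
    by apply: le_trans (les 0 n); have /andP[] := angle_sum_bounds 0 n.
  by apply: ge_sup => // _ [k _ <-]; have /andP[] := angle_sum_bounds k n.
apply/cvg_ex; exists l%:E.
by under eq_fun do rewrite sE -EFinM; apply: cvg_EFin => //; exact: nearW.
Qed.

Lemma cvg_inf_shifts : cvgn (fun n =>
  (n%:R^-1)%:E * ereal_inf [set (a k n)%:E | k in [set: nat]])%E.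
Proof.
have /cvg_ex[l hl] : cvgn (fun n => n%:R^-1 * (pi * n%:R - i n)).
  apply: (@fekete _ _ pi) => [m n|n].
    suff : i m + i n <= i (m + n)%N by rewrite natrD; lra.
    apply: lb_le_inf => // _ [k _ <-].
    by rewrite angle_sumD lerD.
  rewrite subr_ge0 gerBl; apply/andP; split.
    by apply: le_trans (gei 0 n) _; have /andP[] := angle_sum_bounds 0 n.
  by apply: lb_le_inf => // _ [k _ <-]; have /andP[] := angle_sum_bounds k n.
apply/cvg_ex; exists (pi - l)%:E.
under eq_fun do rewrite iE -EFinM.
apply: cvg_EFin; first exact: nearW.
have h : (fun n => pi - n%:R^-1 * (pi * n%:R - i n)) @ \oo --> pi - l.
  by apply: cvgB => //; exact: cvg_cst.
apply: cvg_trans h; apply: near_eq_cvg; near=> n.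
have n0 : n%:R != 0 :> R.
  by rewrite pnatr_eq0 -lt0n; near: n; exact: nbhs_infty_gt.
by rewrite /=; field.
Unshelve. all: by end_near. Qed.

End LimitsExist.

(* Main.v *)
Require Import Defs.
From HB Require Import structures.
From mathcomp Require Import all_boot all_order all_algebra.
From mathcomp Require Import all_classical all_reals all_analysis.
From mathcomp Require Import complex.
From mathcomp Require Import zify ring lra.

Set Implicit Arguments.
Unset Strict Implicit.
Unset Printing Implicit Defensive.

Import Order.TTheory GRing.Theory Num.Theory.
Import numFieldNormedType.Exports.

Local Open Scope classical_set_scope.
Local Open Scope ring_scope.

(** Write [A = lambda *: (1 + N)].  Since [lambda] is the only complex eigenvalue,
    the characteristic polynomial of [A] is [('X - lambda) ^+ d], so by
    Cayley-Hamilton [N] is nilpotent ([nilpotent_sub_scalar]).  Expanding by the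
    binomial theorem, every coordinate of [lambda ^- j *: A ^+ j *m v] is the value
    at [j] of a real polynomial with at most [d] coefficients
    ([exprD1_nilp_poly]), and the scalar [lambda ^- j] does not affect angles.

    A polynomial [p] of bounded degree varies slowly away from its complex
    roots: writing it as a product of linear factors, [p.[j - 1]] and [p.[j]]
    are close in relative terms as soon as [j] is at distance at least [M] from
    each root, [M] being large in terms of the degree only.  The integers that
    violate this are at most [2 * M] for each root, whatever the roots are
    ([poly_slow]).  When all the coordinates vary slowly, the angle between
    consecutive iterates is small ([vangle_le]); at the exceptional times, whose
    number is bounded in terms of [d] and the precision only, it is at most [pi].

    Hence for each [eps > 0] there is a constant [K] such that
    [angle_sum A k n V <= eps * n + K] for all lines [V] and all [k] and [n]
    ([angle_sum_sublinear]).  This estimate is uniform in [V] and [k], so all the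
    averages of the eight definitions tend to [0] ([cvg_average0]). *)

(** * Slow variation of polynomials away from their roots *)

(** A set of integers of diameter less than [L] has at most [L] elements. *)
Lemma sum_pred_le (P : pred nat) (L a b : nat) :
  (forall j k, P j -> P k -> k < j + L)%N ->
  (\sum_(a <= j < b) P j <= L)%N.
Proof.
move=> PL.
have -> : (\sum_(a <= j < b) P j)%N = size [seq j <- index_iota a b | P j].
  rewrite size_filter -sum1_count [RHS]big_mkcond.
  by apply: eq_bigr => j _; case: (P j).
have [[j Pj]|noP] := pselect (exists j, P j); last first.
  rewrite size_filter (eq_count (a2 := pred0)) ?count_pred0 // => j.
  by apply/negbTE/negP => Pj; apply: noP; exists j.
case: (ex_minnP (ex_intro (fun j => P j) j Pj)) => j0 Pj0 j0_min.
rewrite -(size_iota j0 L); apply: uniq_leq_size.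
  exact: filter_uniq (iota_uniq _ _).
by move=> k; rewrite mem_filter mem_iota => /andP[Pk _]; rewrite j0_min // PL.
Qed.

Lemma sum_near_le (C : numDomainType) (z : C) (M a b : nat) :
  (\sum_(a <= j < b) (`|j%:R - z| < M%:R)%R <= 2 * M)%N.
Proof.
apply: sum_pred_le => j k jz kz.
rewrite ltnNge; apply/negP => le_jk.
have : `|k%:R - j%:R| < (2 * M)%:R :> C.
  have -> : k%:R - j%:R = (k%:R - z) - (j%:R - z) by ring.
  by rewrite mul2n -addnn natrD; apply: le_lt_trans (ler_normB _ _) (ltrD kz jz).
rewrite -natrB; last by apply: leq_trans le_jk; rewrite leq_addr.
by rewrite normr_nat ltr_nat; lia.
Qed.

(** If [t] is at distance at least [x^-1] from each [z], then evaluating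
    [\prod_z ('X - z)] at [t - 1] instead of [t] causes a relative error of order
    [x]; the constant depends on the number of factors only. *)
Lemma prod_shift_close (C : numDomainType) (s : seq C) (x t : C) :
  0 <= x <= 1 -> (forall z, z \in s -> 1 <= x * `|t - z|) ->
  `|\prod_(z <- s) (t - 1 - z) - \prod_(z <- s) (t - z)|
    <= (2 ^+ size s - 1) * x * `|\prod_(z <- s) (t - z)|.
Proof.
(* Each new factor at most doubles the error, since [`|t - 1 - z| <= 2 * `|t - z|],
   and adds [x] to it. *)
move=> /andP[x0 x1]; elim: s => [|z s IHs] sx.
  by rewrite !big_nil !subrr normr0 !mul0r.
have {IHs} IHs := IHs (fun y ys => sx y (mem_behead (s := z :: s) ys)).
have xz := sx z (mem_head _ _).
have one_le : 1 <= `|t - z| by apply: le_trans xz _; rewrite ler_piMl.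
rewrite !big_cons /=.
set P' := \prod_(_ <- s) (t - 1 - _) in IHs *.
set P := \prod_(_ <- s) _ in IHs *.
have -> : (t - 1 - z) * P' - (t - z) * P = (t - 1 - z) * (P' - P) - P by ring.
apply: le_trans (ler_normB _ _) _; rewrite !normrM.
have a'_le : `|t - 1 - z| <= 2 * `|t - z|.
  have -> : t - 1 - z = (t - z) - 1 by ring.
  by apply: le_trans (ler_normB _ _) _; rewrite normr1 mulr2n mulrDl mul1r lerD2l.
have h1 := ler_pM (normr_ge0 _) (normr_ge0 _) a'_le IHs.
have h2 : `|P| <= x * `|t - z| * `|P| by rewrite ler_peMl.
apply: le_trans (lerD h1 h2) _.
by rewrite exprS le_eqVlt; apply/orP; left; apply/eqP; ring.
Qed.

(** Unlike [closed_field_poly_normal], this bounds the number of linear factors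
    also when [p = 0]. *)
Lemma size_closed_normal (F : closedFieldType) (p : {poly F}) :
  exists2 s : seq F, (size s <= size p)%N &
    p = lead_coef p *: \prod_(z <- s) ('X - z%:P).
Proof.
have [->|p0] := eqVneq p 0; first by exists [::] => //; rewrite lead_coef0 scale0r.
have [s pE] := closed_field_poly_normal p; exists s => //.
by rewrite pE size_scale ?lead_coef_eq0 // size_prod_XsubC.
Qed.

(** The bound [L] on the number of bad times, those near some complex root
    of [p], does not depend on [p]. *)
Lemma poly_slow (R : realType) (m : nat) (delta : R) : 0 < delta ->
  exists L : nat, forall p : {poly R}, (size p <= m)%N ->
  exists2 bad : pred nat, (forall a b, \sum_(a <= j < b) bad j <= L)%N &
    forall j, ~~ bad j.+1 ->
      `|p.[j%:R] - p.[j.+1%:R]| <= delta * `|p.[j.+1%:R]|.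
Proof.
move=> delta0.
(* With [x = 1 / M], the relative error of [prod_shift_close] is at most [delta]. *)
pose M := (Num.bound (2 ^+ m / delta)).+1.
exists (m * (2 * M))%N => p pm.
pose f : {rmorphism R -> complex R} := real_complex R.
have [s sm pE] := size_closed_normal (map_poly f p).
rewrite size_map_poly in sm.
pose near_root j z := (`|j%:R - z| < M%:R :> complex R).
exists (fun j => has (near_root j) s) => [a b|j].
  apply: (@leq_trans (\sum_(a <= j < b) \sum_(z <- s) near_root j z)%N).
    apply: leq_sum => j _.
    by elim: (s) => //= z r IHr; rewrite big_cons; case: (near_root j z).
  rewrite exchange_big /= (@leq_trans (\sum_(z <- s) 2 * M)%N) //.
    by apply: leq_sum => z _; exact: sum_near_le.
  rewrite big_const_seq count_predT iter_addn_0 mulnC leq_mul //.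
  exact: leq_trans sm pm.
rewrite -all_predC => /allP far.
pose x : complex R := M%:R^-1.
have M0 : 0 < M%:R :> complex R by rewrite ltr0n.
have x01 : 0 <= x <= 1 by rewrite invr_ge0 ler0n invf_le1 // ler1n.
have xs z : z \in s -> 1 <= x * `|j.+1%:R - z|.
  move=> /far /=; rewrite -real_leNgt ?normr_real ?realn // => Mz.
  by rewrite ler_pdivlMl ?mulr1.
(* Multiplying by the leading coefficient turns the products into values of [p];
   the resulting inequality between complex moduli is then brought back to [R]. *)
have := prod_shift_close x01 xs.
have -> : j.+1%:R - 1 = j%:R :> complex R by rewrite -natr1 addrK.
move=> /(ler_wpM2l (normr_ge0 (lead_coef (map_poly f p)))).
have evalE k : lead_coef (map_poly f p) * \prod_(z <- s) (k%:R - z) = f p.[k%:R].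
  rewrite -(horner_map f) rmorph_nat /= {2}pE hornerZ horner_prod.
  by under [in RHS]eq_bigr do rewrite hornerXsubC.
rewrite -normrM mulrBr !evalE mulrCA -normrM evalE -rmorphB /=.
rewrite !normc_def /= !expr0n /= !addr0 !sqrtr_sqr => h.
have {h} h : `|p.[j%:R] - p.[j.+1%:R]|
    <= (2 ^+ size s - 1) / M%:R * `|p.[j.+1%:R]|.
  rewrite -lecR; apply: le_trans h _.
  rewrite le_eqVlt; apply/orP; left; apply/eqP.
  by rewrite rmorphM rmorphM rmorphB rmorphXn fmorphV !rmorph_nat.
apply: le_trans h _; rewrite ler_wpM2r // ler_pdivrMr ?ltr0n //.
rewrite mulrC -ler_pdivrMr //.
apply: (@le_trans _ _ (2 ^+ m / delta)).
  rewrite ler_wpM2r ?invr_ge0 ?(ltW delta0) //.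
  rewrite (@le_trans _ _ (2 ^+ size s)) ?gerBl // ler_weXn2l ?ler1n //.
  exact: leq_trans sm pm.
have := archi_boundP (x := 2 ^+ m / delta); rewrite divr_ge0 ?exprn_ge0 ?(ltW delta0) //.
by move=> /(_ isT) /ltW h; apply: le_trans h _; rewrite ler_nat.
Qed.

(** * Powers of a matrix with a single eigenvalue *)

(** The binomial coefficient ['C(n, i)] as a polynomial in [n]. *)
Definition binom_poly (F : numFieldType) (i : nat) : {poly F} :=
  i`!%:R^-1 *: \prod_(0 <= l < i) ('X - l%:R%:P).

Lemma size_binom_poly (F : numFieldType) i : size (binom_poly F i) = i.+1.
Proof.
rewrite size_scale ?invr_eq0 ?pnatr_eq0 -?lt0n ?fact_gt0 //.
by rewrite size_prod_XsubC size_iota subn0.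
Qed.

Lemma horner_binom_poly (F : numFieldType) i n :
  (binom_poly F i).[n%:R] = 'C(n, i)%:R.
Proof.
have i0 : i`!%:R != 0 :> F by rewrite pnatr_eq0 -lt0n fact_gt0.
apply: (mulfI i0); rewrite hornerZ mulVKf // -natrM mulnC bin_ffact.
rewrite horner_prod; elim: i {i0} => [|i IHi]; first by rewrite big_geq.
rewrite big_nat_recr //= IHi hornerXsubC ffactnSr natrM.
have [le_in|lt_ni] := leqP i n; first by rewrite natrB.
by rewrite (ffact_small lt_ni) !mul0r.
Qed.

(** The orbit of a vector under a unipotent matrix is polynomial in time. *)
Lemma exprD1_nilp_poly (F : numFieldType) (d : nat) (N : 'M[F]_d.+1) (m : nat)
    (v : 'cV[F]_d.+1) : N ^+ m = 0 ->
  exists2 p : 'I_d.+1 -> {poly F}, (forall i, size (p i) <= m)%N &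
    forall j i, ((N + 1) ^+ j *m v) i 0 = (p i).[j%:R].
Proof.
move=> Nm0.
exists (fun i => \sum_(l < m) (N ^+ l *m v) i 0 *: binom_poly F l) => [i|j i].
  apply: (leq_trans (size_sum _ _ _)); apply/bigmax_leqP => l _.
  by apply: leq_trans (size_scale_leq _ _) _; rewrite size_binom_poly.
(* The sum over [l < j.+1] of the binomial theorem and the sum over [l < m] agree,
   as the terms vanish both for [j < l] and for [m <= l]. *)
pose T l := (N ^+ l *m v) i 0 * 'C(j, l)%:R.
have -> : ((N + 1) ^+ j *m v) i 0 = \sum_(0 <= l < j.+1) T l.
  rewrite exprD1n mulmx_suml summxE big_mkord; apply: eq_bigr => l _.
  by rewrite -scaler_nat -scalemxAl mxE mulrC.
rewrite horner_sum.
have -> : \sum_(l < m) ((N ^+ l *m v) i 0 *: binom_poly F l).[j%:R]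
    = \sum_(0 <= l < m) T l.
  by rewrite big_mkord; apply: eq_bigr => l _; rewrite hornerZ horner_binom_poly.
have ext a b : (forall l, (a <= l)%N -> T l = 0) ->
    \sum_(0 <= l < a + b) T l = \sum_(0 <= l < a) T l.
  move=> T0; rewrite (@big_cat_nat _ _ _ a) ?leq_addr //= [X in _ + X]big_nat_cond.
  by rewrite [X in _ + X]big1 ?addr0 // => l /andP[/andP[/T0]].
rewrite -(ext j.+1 m); last by move=> l jl; rewrite /T bin_small ?mulr0.
rewrite addnC ext // => l ml; rewrite /T -(subnK ml) exprD Nm0 mulr0.
by rewrite mul0mx mxE mul0r.
Qed.

Lemma nilpotent_sub_scalar (R : realType) (d : nat) (A : 'M[R]_d.+1) (lambda : R) :
  spectrum A = [set real_complex R lambda] -> (A - lambda%:M) ^+ d.+1 = 0.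
Proof.
move=> spA; set f := real_complex R.
have charE : char_poly A = ('X - lambda%:P) ^+ d.+1.
  apply: (map_poly_inj f); rewrite map_char_poly rmorphXn /= map_polyXsubC.
  have [s sE] := closed_field_poly_normal (char_poly (map_mx f A)).
  rewrite (monicP (char_poly_monic _)) scale1r in sE.
  have sz : size s = d.+1.
    by apply: succn_inj; rewrite -(size_char_poly (map_mx f A)) sE size_prod_XsubC.
  rewrite sE big_seq (eq_bigr (fun=> 'X - (f lambda)%:P)).
    by rewrite -big_seq big_const_seq count_predT sz iter_mulr_1.
  move=> z zs; suff -> : z = f lambda by [].
  have : spectrum A z.
    by rewrite /spectrum /= eigenvalue_root_char sE root_prod_XsubC.
  by rewrite spA.
have := Cayley_Hamilton A; rewrite charE rmorphXn /= rmorphB /=.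
by rewrite horner_mx_X horner_mx_C.
Qed.

Lemma spectrum1_unitmx (R : realType) (d : nat) (A : 'M[R]_d) (lambda : R) :
  lambda != 0 -> spectrum A = [set real_complex R lambda] -> A \in unitmx.
Proof.
move=> l0 spA; rewrite -(map_unitmx (real_complex R)).
apply: contraT => An; have : spectrum A 0.
  rewrite /spectrum /= /eigenvalue /eigenspace raddf0 subr0.
  by rewrite kermx_eq0 row_free_unit.
by rewrite spA /= => /esym/eqP; rewrite fmorph_eq0 (negPf l0).
Qed.

(** * Angles along the orbit of a line *)

(** Vectors that are coordinatewise close in relative terms make a small angle:
    the cosine is at least [(1 - delta) / (1 + delta)]. *)
Lemma vangle_le (R : realType) (d : nat) (u w : 'cV[R]_d) (eps delta : R) :
  0 <= eps <= pi -> 0 <= delta < 1 -> cos eps * (1 + delta) <= 1 - delta ->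
  w != 0 -> (forall i, `|u i 0 - w i 0| <= delta * `|w i 0|) ->
  vangle u w <= eps.
Proof.
move=> epsP /andP[delta0 delta1] cos_le w0 uw.
have ww0 : 0 < dot w w.
  rewrite lt_neqAle dot_ge0 andbT eq_sym; apply: contra w0.
  rewrite dotE psumr_eq0; last by move=> i _; exact: sqr_ge0.
  move=> /allP ww; apply/eqP/matrixP => i j; rewrite ord1 mxE.
  by have := ww i (mem_index_enum i); rewrite mulf_eq0 orbb => /eqP.
have uw_ge : (1 - delta) * dot w w <= dot u w.
  rewrite !dotE mulr_sumr; apply: ler_sum => i _.
  have := uw i; rewrite ler_norml => /andP[h1 h2].
  have [wi|wi] := lerP 0 (w i 0); move: h1 h2.
    by rewrite ger0_norm //; nra.
  by rewrite ltr0_norm //; nra.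
have uu_le : dot u u <= (1 + delta) ^+ 2 * dot w w.
  rewrite !dotE mulr_sumr; apply: ler_sum => i _.
  have h : `|u i 0| <= (1 + delta) * `|w i 0|.
    have -> : u i 0 = (u i 0 - w i 0) + w i 0 by ring.
    by apply: le_trans (ler_normD _ _) _; rewrite addrC mulrDl mul1r lerD2l.
  rewrite -!expr2 -(real_normK (num_real (u i 0))).
  rewrite -(real_normK (num_real (w i 0))).
  by rewrite -exprMn lerXn2r ?nnegrE ?mulr_ge0 ?addr_ge0.
have nw0 : 0 < enorm w by rewrite sqrtr_gt0.
have uw0 : 0 < dot u w by apply: lt_le_trans uw_ge; rewrite mulr_gt0 ?subr_gt0.
have nu0 : 0 < enorm u.
  rewrite sqrtr_gt0 lt_neqAle dot_ge0 andbT eq_sym; apply/eqP => uu0.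
  have := cauchy_schwarz u w; rewrite uu0 mul0r leNgt.
  by rewrite exprn_gt0.
have nu_le : enorm u <= (1 + delta) * enorm w.
  rewrite -[1 + delta]ger0_norm ?addr_ge0 // -sqrtr_sqr -sqrtrM ?sqr_ge0 //.
  exact: ler_wsqrtr.
have ratio : cos eps <= `|dot u w| / (enorm u * enorm w).
  have [c0|c0] := lerP (cos eps) 0.
    by apply: le_trans c0 _; case/andP: (cosine_bounds u w).
  rewrite ler_pdivlMr ?mulr_gt0 // (ger0_norm (ltW uw0)).
  apply: le_trans uw_ge.
  have -> : dot w w = enorm w * enorm w by rewrite -expr2 sqr_sqrtr ?dot_ge0.
  rewrite mulrA [leRHS]mulrA ler_wpM2r ?(ltW nw0) //.
  apply: le_trans (ler_wpM2l (ltW c0) nu_le) _.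
  by rewrite mulrA ler_wpM2r ?(ltW nw0).
have /andP[r0 r1] := cosine_bounds u w.
have rb : -1 <= `|dot u w| / (enorm u * enorm w) <= 1.
  by rewrite r1 (le_trans _ r0) // oppr_le0.
rewrite leNgt; apply/negP => eps_lt.
have : cos (vangle u w) < cos eps.
  by rewrite ltr_cos // in_itv /= ?vangle_bounds.
by rewrite /vangle acosK ?in_itv //= ltNge ratio.
Qed.

Lemma lineP (K : fieldType) (vT : vectType K) (V : {vspace vT}) :
  \dim V = 1%N -> exists2 v, v != 0 & V = <[v]>%VS.
Proof.
move=> V1; have v0 : vpick V != 0.
  by rewrite vpick0; apply/eqP => V0; move: V1; rewrite V0 dimv0.
exists (vpick V) => //; apply/esym/eqP.
by rewrite eqEdim V1 dim_vline v0 andbT -memvE memv_pick.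
Qed.

Lemma pow_image_line (R : realType) (d : nat) (A : 'M[R]_d.+1) v j :
  pow_image A j <[v]> = <[A ^+ j *m v]>%VS.
Proof.
elim: j => [|j IHj]; first by rewrite expr0 mul1mx.
rewrite /pow_image iterS -/(pow_image A j _) IHj limg_line lfunE /=.
by rewrite exprS -mulmxE mulmxA.
Qed.

(** The main estimate.  The constant [K] depends neither on the line [V] nor on
    the shift [k]. *)
Lemma angle_sum_sublinear (R : realType) (d : nat) (A : 'M[R]_d) (lambda : R) :
  lambda != 0 -> spectrum A = [set real_complex R lambda] ->
  forall eps : R, 0 < eps -> exists K : R, forall V, grassmannian 1 V ->
  forall k n, angle_sum A k n V <= eps * n%:R + K.
Proof.
move=> l0; case: d A => [|d] A spA.
  move=> eps _; exists 0 => V /= V1.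
  by have := dimvS (subvf V); rewrite V1 dimvf dim_matrix.
move=> eps eps0.
(* [cos] is decreasing on [`[0, pi]] only, hence the truncation of [eps]. *)
pose eps' := Num.min eps (pi / 2).
have pi0 : 0 < pi :> R := pi_gt0 R.
have eps'_bd : 0 < eps' < pi.
  rewrite /eps' lt_min eps0 divr_gt0 //= gt_min ltr_pdivrMr //.
  by rewrite ltr_pMr // ltr1n orbT.
have c1 : cos eps' < 1.
  case/andP: eps'_bd => eps'0 eps'pi.
  by rewrite -cos0 ltr_cos // in_itv /= ?lexx ?pi_ge0 // !ltW.
have cN1 := cos_geN1 eps'.
(* As [-1 <= cos eps' < 1], this choice gives
   [cos eps' * (1 + delta) <= 1 - delta]. *)
pose delta := (1 - cos eps') / 4.
have delta0 : 0 < delta by rewrite /delta; lra.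
have delta1 : delta < 1 by rewrite /delta; lra.
have [L HL] := poly_slow d.+1 delta0.
exists (pi * (d.+1 * L)%:R) => V /lineP[v v0 ->{V}] k n.
pose N := lambda^-1 *: A - 1.
have AE : A = lambda *: (N + 1) by rewrite /N subrK scalerA divff // scale1r.
have Nd : N ^+ d.+1 = 0.
  have -> : N = lambda^-1 *: (A - lambda%:M).
    by rewrite /N scalerBr scale_scalar_mx mulVf.
  by rewrite exprZn (nilpotent_sub_scalar spA) scaler0.
have [p szp pE] := exprD1_nilp_poly v Nd.
pose u j := (N + 1) ^+ j *m v.
have Aju j : A ^+ j *m v = lambda ^+ j *: u j by rewrite AE exprZn scalemxAl.
have Ajv0 j : A ^+ j *m v != 0.
  have Aj : A ^+ j \in unitmx by rewrite unitrX // (spectrum1_unitmx l0 spA).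
  by apply: contra v0 => /eqP Av; rewrite -(mulKmx Aj v) Av mulmx0.
have u0 j : u j != 0.
  by apply: contra (Ajv0 j) => /eqP uj; rewrite Aju uj scaler0.
have [bad badP] : exists bad : 'I_d.+1 -> pred nat, forall i,
    (forall a b, \sum_(a <= j < b) bad i j <= L)%N /\
    forall j, ~~ bad i j.+1 ->
      `|(p i).[j%:R] - (p i).[j.+1%:R]| <= delta * `|(p i).[j.+1%:R]|.
  suff /choice[bad badP] : forall i, exists bad : pred nat,
      (forall a b, \sum_(a <= j < b) bad j <= L)%N /\
      forall j, ~~ bad j.+1 ->
        `|(p i).[j%:R] - (p i).[j.+1%:R]| <= delta * `|(p i).[j.+1%:R]|.
    by exists bad.
  by move=> i; have [bad b1 b2] := HL _ (szp i); exists bad.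
(* At each time at which some coordinate is bad, the angle is only bounded
   by [pi]. *)
have step j : (0 < j)%N ->
    angle (pow_image A j.-1 <[v]>) (pow_image A j <[v]>)
      <= eps + pi * (\sum_i bad i j)%:R.
  case: j => // j _.
  rewrite !pow_image_line angle_line // !Aju vangleZ ?expf_neq0 //=.
  have [good|] := eqVneq (\sum_i bad i j.+1)%N 0%N.
    rewrite good mulr0 addr0.
    apply: (@le_trans _ _ eps'); last by rewrite /eps' ge_min lexx.
    apply: (@vangle_le _ _ _ _ _ delta) => //.
    - by case/andP: eps'_bd => /ltW-> /ltW->.
    - by rewrite (ltW delta0).
    - by rewrite /delta; nra.
    move=> i; rewrite !pE; apply: (badP i).2.
    move/eqP: good; rewrite sum_nat_eq0 => /forallP/(_ i) /=.
    by case: (bad i j.+1).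
  rewrite -lt0n => h; apply: (@le_trans _ _ pi).
    by case/andP: (vangle_bounds (u j) (u j.+1)).
  by rewrite ler_wpDl ?(ltW eps0) // ler_peMr ?ler1n // ltW.
rewrite /angle_sum big_nat.
apply: (@le_trans _ _
  (\sum_(k.+1 <= j < (k + n).+1) (eps + pi * (\sum_i bad i j)%:R))).
  rewrite [leRHS]big_nat; apply: ler_sum => j /andP[kj _].
  by apply: step; apply: leq_trans kj.
rewrite big_split /= sumr_const_nat subSS addKn mulr_natr lerD2l.
rewrite -mulr_sumr ler_wpM2l ?(ltW pi0) // -natr_sum ler_nat exchange_big /=.
rewrite (@leq_trans (\sum_(i < d.+1) L)%N) //.
  by apply: leq_sum => i _; exact: (badP i).1.
by rewrite sum_nat_const card_ord.
Qed.

(** * The eight angular values *)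

Lemma grassmannian1_neq0 (R : realType) (d : nat) : (0 < d)%N ->
  @grassmannian R d 1 !=set0.
Proof.
case: d => // d _; exists <[const_mx 1]>%VS.
rewrite /grassmannian /= dim_vline.
suff -> : const_mx 1 != 0 :> 'cV[R]_d.+1 by [].
by apply/eqP => /matrixP/(_ 0 0)/eqP; rewrite !mxE oner_eq0.
Qed.

(** At [n = 0] the average is [0^-1 * F 0 = 0]; only large [n] matter. *)
Lemma cvg_average0 (R : realType) (F : nat -> \bar R) :
  (forall n, 0 <= F n)%E ->
  (forall eps, 0 < eps -> exists K, forall n, (F n <= (eps * n%:R + K)%:E)%E) ->
  (fun n => (n%:R^-1)%:E * F n)%E @ \oo --> 0%E.
Proof.
move=> F0 FK.
have FE n : F n = (fine (F n))%:E.
  have [K /(_ n) FnK] := FK 1 ltr01.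
  by rewrite fineK // ge0_fin_numE // (le_lt_trans FnK) // ltry.
under eq_fun do rewrite FE -EFinM.
apply: cvg_EFin; first exact: nearW.
apply/cvgrPdist_le => e e0; rewrite /=.
have e20 : 0 < e / 2 by rewrite divr_gt0.
have [K FnK] := FK _ e20.
near=> n.
have n0 : 0 < n%:R :> R by rewrite ltr0n; near: n; exact: nbhs_infty_gt.
rewrite sub0r normrN ger0_norm; last first.
  by rewrite mulr_ge0 ?invr_ge0 ?(ltW n0) // fine_ge0.
rewrite ler_pdivrMl //.
have := FnK n; rewrite FE lee_fin => h; apply: le_trans h _.
have h : K / (e / 2) <= n%:R by near: n; exact: nbhs_infty_ger.
by move: h; rewrite ler_pdivrMr //; lra.
Unshelve. all: by end_near. Qed.

Theorem proposition5p4 (R : realType) (d : nat) (A : 'M[R]_d) (lambda : R)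
    (lambda_neq0 : lambda != 0)
    (spectrumA : spectrum A = [set real_complex R lambda]) :
  uniform_outer_lower A = 0%E /\
  outer_lower A = 0%E /\
  outer_upper A = 0%E /\
  uniform_outer_upper A = 0%E /\
  uniform_inner_lower A = 0%E /\
  inner_lower A = 0%E /\
  inner_upper A = 0%E /\
  uniform_inner_upper A = 0%E.
Proof.
(* The empty matrix has empty spectrum. *)
have d0 : (0 < d)%N.
  case: d A spectrumA => // A spA.
  have : spectrum A (real_complex R lambda) by rewrite spA.
  by rewrite /spectrum /= => /eigenvalueP[v _ /eqP[]]; apply/rowP => -[].
have bound := angle_sum_sublinear lambda_neq0 spectrumA.
have ge0 k n V : (0 <= (angle_sum A k n V)%:E)%E.
  by rewrite lee_fin; case/andP: (angle_sum_bounds A V k n).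
have [V0 V0P] := grassmannian1_neq0 R d0.
(* Lines exist because [0 < d]; over the empty set the supremum would be [-oo]. *)
have sup_lines0 (F : {vspace 'cV[R]_d} -> \bar R) :
    (forall V, grassmannian 1 V -> F V = 0%E) ->
    ereal_sup [set F V | V in grassmannian 1] = 0%E.
  move=> F0; rewrite -[RHS]ereal_sup1; congr ereal_sup.
  apply/seteqP; split => [_ [V VP <-]|_ ->]; first by rewrite /= F0.
  by exists V0; rewrite // F0.
(* [G n V] ranges over the plain sum and the supremum and infimum over shifts,
   all of which inherit any bound that holds for all the shifts. *)
have averages0 (G : nat -> {vspace 'cV[R]_d} -> \bar R) :
    (forall n V, 0 <= G n V)%E ->
    (forall n V b, (forall k, angle_sum A k n V <= b) -> (G n V <= b%:E)%E) ->
    (forall V, grassmannian 1 V ->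
      (fun n => (n%:R^-1)%:E * G n V)%E @ \oo --> 0%E) /\
    (fun n => (n%:R^-1)%:E * ereal_sup [set G n V | V in grassmannian 1])%E
      @ \oo --> 0%E.
  move=> G0 Gle; split=> [V VP|]; apply: cvg_average0.
  - by move=> n; exact: G0.
  - move=> eps /bound[K HK]; exists K => n.
    by apply: Gle => k; exact: HK.
  - by move=> n; apply: le_trans (G0 n V0) _; apply: ereal_sup_ubound; exists V0.
  - move=> eps /bound[K HK]; exists K => n; apply: ge_ereal_sup => _ [V VP <-].
    by apply: Gle => k; exact: HK.
have [plain plain_sup] := averages0 (fun n V => (angle_sum A 0 n V)%:E)
  (fun n V => ge0 0%N n V) (fun n V b le_b => le_b 0%N).
have [||upper upper_sup] := averages0
  (fun n V => ereal_sup [set (angle_sum A k n V)%:E | k in [set: nat]]).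
- move=> n V; apply: le_trans (ge0 0%N n V) _.
  by apply: ereal_sup_ubound; exists 0%N.
- by move=> n V b le_b; apply: ge_ereal_sup => _ [k _ <-]; exact: le_b.
have [||lower lower_sup] := averages0
  (fun n V => ereal_inf [set (angle_sum A k n V)%:E | k in [set: nat]]).
- by move=> n V; apply/ereal_infP => _ [k _ <-].
- move=> n V b le_b; apply: le_trans (_ : (angle_sum A 0 n V)%:E <= _)%E.
    by apply: ereal_inf_lbound; exists 0%N.
  exact: le_b.
split; first by apply: sup_lines0 => V VP; exact: cvg_lim (lower V VP).
split; first by apply: sup_lines0 => V VP; exact: (cvg_limn_einf_sup (plain V VP)).1.
split; first by apply: sup_lines0 => V VP; exact: (cvg_limn_einf_sup (plain V VP)).2.
split; first by apply: sup_lines0 => V VP; exact: cvg_lim (upper V VP).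
split; first exact: (cvg_limn_einf_sup lower_sup).1.
split; first exact: (cvg_limn_einf_sup plain_sup).1.
split; first exact: (cvg_limn_einf_sup plain_sup).2.
exact: (cvg_limn_einf_sup upper_sup).2.
Qed.
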